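(* Let $N \ge 2$. Interruptible exact sampling from the stationary distribution is not possible when one observes only a single trajectory from an irreducible aperiodic reversible Markov chain on $N$ states. That is, there is no collection of functions $\phi_{k,i}: [N]^{k+1}\to[0,1]$ ($k\ge 0$, $i\in[N]$) satisfying properties (i), (ii), (iii) and (iv$'$) of the context, in which (iii) and (iv$'$) are required only for reversible chains.
   Context: Write $[N]=\{1,\dots,N\}$. A transition matrix $\mathbf{P}=(p_{ij})$ with stationary distribution $\pi$ is reversible if $\pi_i p_{ij} = \pi_j p_{ji}$ for all $i,j$. A (passive, single-trajectory) algorithm is a collection of functions $\phi_{k,i}: [N]^{k+1}\to[0,1]$, where $\phi_{k,i}(x_0,\dots,x_k)$ is interpreted as the conditional probability that the algorithm stops by time $k$ and outputs $i$, given that it sees the trajectory $(x_0,\dots,x_k)$ through time $k$. The functions do not depend on the transition matrix or the initial distribution. For a probability distribution $\rho$ on $[N]$ and a transition matrix $\mathbf{P}=(p_{ij})$ put $$a_{k,i}(\rho,\mathbf{P}) := \sum_{x_0,\dots,x_k\in[N]} \rho_{x_0} p_{x_0,x_1}\cdots p_{x_{k-1},x_k}\,\phi_{k,i}(x_0,\dots,x_k).$$ The required properties are: (i) for all $k\ge 0$ and all $(x_0,\dots,x_k)\in[N]^{k+1}$: $\sum_{j\in[N]}\phi_{k,j}(x_0,\dots,x_k)\le 1$; (ii) for all $i\in[N]$ and all $(x_0,x_1,\dots)\in[N]^\infty$, $\phi_{k,i}(x_0,\dots,x_k)$ is nondecreasing in $k$; and, for every irreducible aperiodic reversible transition matrix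 $\mathbf{P}$ on $[N]$ with stationary distribution $\pi$, and every probability distribution $\rho$ on $[N]$: (iii) $\lim_{k\to\infty}\sum_{j\in[N]} a_{k,j}(\rho,\mathbf{P}) > 0$ (the algorithm stops with positive probability); (iv$'$) for all $i\in[N]$ and all $k\ge 0$: $a_{k,i}(\rho,\mathbf{P}) = \pi_i\sum_{j\in[N]} a_{k,j}(\rho,\mathbf{P})$ (the output is distributed as $\pi$, independently of the stopping time). *)

(* Defs.v *)
From HB Require Import structures.
From mathcomp Require Import all_boot all_order all_algebra.
From mathcomp Require Import all_classical all_reals all_analysis.
Set Implicit Arguments.
Unset Strict Implicit.
Unset Printing Implicit Defensive.
Import Order.TTheory GRing.Theory Num.Theory.
Import numFieldNormedType.Exports.
Local Open Scope classical_set_scope.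
Local Open Scope ring_scope.

(* States 1, ..., N are represented by 'I_N = {0, ..., N-1}; a distribution
   is a row vector and a transition matrix is a row-stochastic matrix. *)

Definition is_distribution (R : realType) (N : nat) (rho : 'rV[R]_N) : Prop :=
  (forall i, 0 <= rho 0 i) /\ \sum_i rho 0 i = 1.

Definition is_transition_matrix (R : realType) (N : nat) (P : 'M[R]_N) : Prop :=
  (forall i j, 0 <= P i j) /\ (forall i, \sum_j P i j = 1).

Definition is_irreducible (R : realType) (N : nat) (P : 'M[R]_N) : Prop :=
  forall i j, exists n : nat, 0 < (P ^+ n) i j.

(* d is the gcd of the (possibly infinite) set of return times
   {n >= 1 | (P^n)_ii > 0}. *)
Definition is_period (R : realType) (N : nat) (P : 'M[R]_N) (i : 'I_N)
    (d : nat) : Prop :=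
  let return_time n := (0 < n)%N /\ 0 < (P ^+ n) i i in
  (forall n, return_time n -> (d %| n)%N) /\
  (forall e : nat, (forall n, return_time n -> (e %| n)%N) -> (e %| d)%N).

Definition is_aperiodic (R : realType) (N : nat) (P : 'M[R]_N) : Prop :=
  forall i, is_period P i 1.

Definition is_stationary (R : realType) (N : nat) (P : 'M[R]_N)
    (pi : 'rV[R]_N) : Prop :=
  is_distribution pi /\ pi *m P = pi.

Definition is_reversible (R : realType) (N : nat) (P : 'M[R]_N)
    (pi : 'rV[R]_N) : Prop :=
  forall i j, pi 0 i * P i j = pi 0 j * P j i.

Record reversible_chain (R : realType) (N : nat) (P : 'M[R]_N)
    (pi : 'rV[R]_N) : Prop := {
  chain_transition : is_transition_matrix P;
  chain_irreducible : is_irreducible P;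
  chain_aperiodic : is_aperiodic P;
  chain_stationary : is_stationary P pi;
  chain_reversible : is_reversible P pi }.

(* [phi k i x] is phi_{k,i}(x_0, ..., x_k), the tuple x having length k + 1. *)
Definition algorithm (R : realType) (N : nat) : Type :=
  forall k : nat, 'I_N -> k.+1.-tuple 'I_N -> R.

Definition prefix_upto (N : nat) (x : nat -> 'I_N) (k : nat) :
    k.+1.-tuple 'I_N :=
  [tuple x i | i < k.+1].

(* In the product over l < k, [widen_ord (leqnSn k) l] is l and [lift ord0 l]
   is l + 1 as elements of 'I_k.+1. *)
Definition trajectory_weight (R : realType) (N : nat) (rho : 'rV[R]_N)
    (P : 'M[R]_N) (k : nat) (x : k.+1.-tuple 'I_N) : R :=
  rho 0 (tnth x ord0) *
  \prod_(l < k) P (tnth x (widen_ord (leqnSn k) l)) (tnth x (lift ord0 l)).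

Definition stop_prob (R : realType) (N : nat) (phi : algorithm R N)
    (rho : 'rV[R]_N) (P : 'M[R]_N) (k : nat) (i : 'I_N) : R :=
  \sum_(x : k.+1.-tuple 'I_N) trajectory_weight rho P x * phi k i x.

Record interruptible_exact_sampler (R : realType) (N : nat)
    (phi : algorithm R N) : Prop := {
  sampler_unit_interval : forall k i (x : k.+1.-tuple 'I_N),
    0 <= phi k i x <= 1;
  sampler_sum_le1 : forall k (x : k.+1.-tuple 'I_N),
    \sum_j phi k j x <= 1;
  sampler_nondecreasing : forall i (x : nat -> 'I_N) (k m : nat), (k <= m)%N ->
    phi k i (prefix_upto x k) <= phi m i (prefix_upto x m);
  sampler_stops : forall (P : 'M[R]_N) (pi rho : 'rV[R]_N),
    reversible_chain P pi -> is_distribution rho ->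
    exists2 l : R,
      (fun k => \sum_j stop_prob phi rho P k j) @ \oo --> l & 0 < l;
  sampler_exact : forall (P : 'M[R]_N) (pi rho : 'rV[R]_N),
    reversible_chain P pi -> is_distribution rho ->
    forall i (k : nat),
      stop_prob phi rho P k i = pi 0 i * \sum_j stop_prob phi rho P k j }.

(* Main.v *)
Require Import Defs.
From mathcomp Require Import all_boot all_order all_algebra.
From mathcomp Require Import all_classical all_reals all_analysis.
From mathcomp Require Import ring lra zify.

(** The obstruction already appears at each fixed time $k$, on a two-parameter
family of reversible chains.  Single out state 0, and let all other states be
exchangeable: the chain leaves 0 with probability $p$, returns to 0 with
probability $q$, and is uniform on the nonzero states whenever it is not at 0
([excursion_chain]).  Then $\pi_0 = q/(p+q)$, so exactness says that
[p * Pr(output 0) = q * Pr(output nonzero)], the algorithm having stopped by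
time $k$ in both cases.

Put $p = r\varepsilon$ and $q = \varepsilon$.  Both probabilities are
polynomials in $\varepsilon$, and the weight of a trajectory has order exactly
$\varepsilon^m$, where $m$ counts its crossings between state 0 and the other
states.  A trajectory started at 0 crosses alternately outwards and
inwards, so exactly $\lceil m/2\rceil$ of its crossings are outward ones: its
leading coefficient depends on $r$ only through the factor
$r^{\lceil m/2\rceil}$, shared by all trajectories with $m$ crossings
([sum_leaves]).  If the algorithm never stops on trajectories from 0 with fewer
than $m$ crossings, the coefficients of $\varepsilon^m$ therefore read
$r F = G$, where $F, G \ge 0$ are positively weighted sums of the stopping probabilities
over trajectories with $m$ crossings and do not depend on $r$.  Taking
$r = 1, 2$ gives $F = G = 0$, so the algorithm does not stop on those
trajectories either ([no_stop_from0]).  By induction on $m$ it never stops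
when started at 0, against the requirement that it stops with positive
probability. *)

Set Implicit Arguments.
Unset Strict Implicit.
Unset Printing Implicit Defensive.
Import Order.TTheory GRing.Theory Num.Theory.
Import numFieldNormedType.Exports.
Local Open Scope ring_scope.

(** * Crossings between state 0 and the other states *)

Definition leaves n (i j : 'I_n.+2) : bool := (i == ord0) && (j != ord0).
Definition crosses n (i j : 'I_n.+2) : bool := (i == ord0) != (j == ord0).

Definition crossings n k (x : k.+1.-tuple 'I_n.+2) : nat :=
  (\sum_(l < k) crosses (tnth x (widen_ord (leqnSn k) l))
                        (tnth x (lift ord0 l)))%N.

(** The parity of the number of crossings records the current side, which is
what makes the alternation an induction. *)
Lemma sum_leaves_nat n (x : nat -> 'I_n.+2) k : x 0%N = ord0 ->
  odd (\sum_(l < k) crosses (x l) (x l.+1)) = (x k != ord0) /\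
  (\sum_(l < k) leaves (x l) (x l.+1))%N =
    uphalf (\sum_(l < k) crosses (x l) (x l.+1)).
Proof.
move=> x0; elim: k => [|k [IHodd IHsum]]; first by rewrite !big_ord0 x0 eqxx.
rewrite !big_ord_recr /= oddD IHodd IHsum /crosses /leaves.
set s := (\sum_(l < k) _)%N in IHodd *.
by case: (x k == ord0) IHodd; case: (x k.+1 == ord0) => /=; split=> //; lia.
Qed.

Lemma sum_leaves n k (x : k.+1.-tuple 'I_n.+2) : tnth x ord0 = ord0 ->
  (\sum_(l < k) leaves (tnth x (widen_ord (leqnSn k) l))
                       (tnth x (lift ord0 l)))%N = uphalf (crossings x).
Proof.
rewrite (tnth_nth ord0) => x0.
have [_ /= sumE] := @sum_leaves_nat n (nth ord0 x) k x0.
rewrite /crossings.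
under eq_bigr => l _ do rewrite !(tnth_nth ord0) lift0.
by rewrite sumE; congr uphalf; apply: eq_bigr => l _;
  rewrite !(tnth_nth ord0) lift0.
Qed.

(** * A two-parameter family of reversible chains *)

(** The probability of landing on [j] given the side of [j]. *)
Definition label_prob (R : realType) n (j : 'I_n.+2) : R :=
  if j == ord0 then 1 else n.+1%:R^-1.

Definition excursion_chain (R : realType) n (p q : R) : 'M[R]_n.+2 :=
  \matrix_(i, j) (label_prob R j *
    if i == ord0 then (if j == ord0 then 1 - p else p)
    else (if j == ord0 then q else 1 - q)).

Definition excursion_stat (R : realType) n (p q : R) : 'rV[R]_n.+2 :=
  \row_j (label_prob R j * (if j == ord0 then q else p) / (p + q)).

Lemma label_prob_gt0 (R : realType) n (j : 'I_n.+2) : 0 < label_prob R j.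
Proof. by rewrite /label_prob; case: ifP; rewrite ?invr_gt0 ?ltr0n. Qed.

Lemma sum_label_prob (R : realType) n (a b : R) :
  \sum_(j < n.+2) label_prob R j * (if j == ord0 then a else b) = a + b.
Proof.
rewrite big_ord_recl /label_prob eqxx mul1r; congr (_ + _).
rewrite (eq_bigr (fun=> n.+1%:R^-1 * b)); last by move=> j _.
by rewrite sumr_const card_ord -[LHS]mulr_natl mulrA divff ?mul1r ?pnatr_eq0.
Qed.

Lemma excursion_chain_gt0 (R : realType) n (p q : R) (i j : 'I_n.+2) :
  0 < p < 1 -> 0 < q < 1 -> 0 < excursion_chain n p q i j.
Proof.
move=> /andP[p0 p1] /andP[q0 q1]; rewrite mxE mulr_gt0 ?label_prob_gt0//.
by case: ifP; case: ifP; rewrite ?subr_gt0.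
Qed.

Lemma excursion_chain_reversible (R : realType) n (p q : R) :
  0 < p < 1 -> 0 < q < 1 ->
  reversible_chain (excursion_chain n p q) (excursion_stat n p q).
Proof.
move=> p01 q01; have Pgt0 i j := excursion_chain_gt0 i j p01 q01.
have [p0 q0] : 0 < p /\ 0 < q by case/andP: p01; case/andP: q01.
have pq0 : 0 < p + q by rewrite addr_gt0.
have trans : is_transition_matrix (excursion_chain n p q).
  split=> [i j|i]; first exact: ltW.
  under eq_bigr => j _ do rewrite mxE.
  by case: (i == ord0); rewrite sum_label_prob; ring.
have rev : is_reversible (excursion_chain n p q) (excursion_stat n p q).
  move=> i j; rewrite !mxE.
  by case: (i == ord0); case: (j == ord0); ring.
split=> //.
- by move=> i j; exists 1%N; rewrite expr1.
- move=> i; split=> [m _|e he]; first exact: dvd1n.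
  by apply: he; rewrite expr1.
- split; last first.
    apply/rowP => j; rewrite mxE.
    under eq_bigr => i _ do rewrite rev.
    by rewrite -mulr_sumr trans.2 mulr1.
  split=> [i|].
    rewrite mxE divr_ge0 ?(ltW pq0)// mulr_ge0 ?(ltW (label_prob_gt0 _ _))//.
    by case: ifP => _; exact: ltW.
  under eq_bigr => j _ do rewrite mxE.
  by rewrite -mulr_suml sum_label_prob addrC divff ?gt_eqF.
Qed.

(** * Expansion along p = r e, q = e *)

(** Polynomial in $\varepsilon$ of the one-step probability, in a form that
displays its order of vanishing at 0. *)
Definition step_poly (R : realType) n (r : R) (i j : 'I_n.+2) : {poly R} :=
  'X^(crosses i j) *
  ((label_prob R j * r ^+ leaves i j)%:P *
   (1 - (if i == ord0 then r else 1) *: 'X) ^+ ~~ crosses i j).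

Definition path_poly (R : realType) n k (r : R) (x : k.+1.-tuple 'I_n.+2) :
    {poly R} :=
  \prod_(l < k) step_poly r (tnth x (widen_ord (leqnSn k) l))
                            (tnth x (lift ord0 l)).

Definition label_weight (R : realType) n k (x : k.+1.-tuple 'I_n.+2) : R :=
  \prod_(l < k) label_prob R (tnth x (lift ord0 l)).

Lemma label_weight_gt0 (R : realType) n k (x : k.+1.-tuple 'I_n.+2) :
  0 < label_weight R x.
Proof. by apply: prodr_gt0 => l _; exact: label_prob_gt0. Qed.

Lemma horner_step_poly (R : realType) n (r e : R) (i j : 'I_n.+2) :
  (step_poly r i j).[e] = excursion_chain n (r * e) e i j.
Proof.
rewrite /step_poly mxE /crosses /leaves.
by case: (i == ord0); case: (j == ord0) => /=; rewrite !hornerE /=; ring.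
Qed.

(** The leading coefficient of a trajectory from 0 depends on [r] only through
its number of crossings. *)
Lemma coef_path_poly (R : realType) n k (r : R) (x : k.+1.-tuple 'I_n.+2) m :
  tnth x ord0 = ord0 -> (m <= crossings x)%N ->
  (path_poly r x)`_m =
    if crossings x == m then r ^+ uphalf m * label_weight R x else 0.
Proof.
move=> x0 le_m; rewrite /path_poly big_split /= prodrXr -/(crossings x) coefXnM.
case: (ltngtP m (crossings x)) le_m => // -> _.
rewrite subnn -horner_coef0 horner_prod -sum_leaves// -prodrXr mulrC.
rewrite -big_split /=; apply: eq_bigr => l _.
by rewrite hornerM hornerC horner_exp !hornerE subr0 expr1n mulr1.
Qed.

(** Polynomial in $\varepsilon$ of the stopping probability from state 0. *)
Definition stop_poly (R : realType) n (phi : algorithm R n.+2) k (r : R)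
    (i : 'I_n.+2) : {poly R} :=
  \sum_(x : k.+1.-tuple 'I_n.+2 | tnth x ord0 == ord0)
    phi k i x *: path_poly r x.

Lemma stop_prob_from0 (R : realType) n (phi : algorithm R n.+2) P k i :
  stop_prob phi (delta_mx 0 ord0) P k i =
  \sum_(x : k.+1.-tuple 'I_n.+2 | tnth x ord0 == ord0)
    phi k i x * \prod_(l < k) P (tnth x (widen_ord (leqnSn k) l))
                                (tnth x (lift ord0 l)).
Proof.
rewrite /stop_prob [RHS]big_mkcond; apply: eq_bigr => x _.
rewrite /trajectory_weight mxE eqxx /=.
by case: (_ == ord0); rewrite ?mul1r ?mul0r // mulrC.
Qed.

Lemma horner_stop_poly (R : realType) n (phi : algorithm R n.+2) k (r e : R)
    (i : 'I_n.+2) :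
  (stop_poly phi k r i).[e] =
  stop_prob phi (delta_mx 0 ord0) (excursion_chain n (r * e) e) k i.
Proof.
rewrite stop_prob_from0 horner_sum; apply: eq_bigr => x _.
rewrite hornerZ horner_prod; congr (_ * _).
by apply: eq_bigr => l _; exact: horner_step_poly.
Qed.

(** What is left of the [m]-th coefficient of [stop_poly] once the power of [r]
is factored out: the $F$ and $G$ of the argument are its value at state 0 and
its sum over the other states. *)
Definition crossing_mass (R : realType) n (phi : algorithm R n.+2) k m
    (i : 'I_n.+2) : R :=
  \sum_(x : k.+1.-tuple 'I_n.+2 | (tnth x ord0 == ord0) && (crossings x == m))
    phi k i x * label_weight R x.

Lemma coef_stop_poly (R : realType) n (phi : algorithm R n.+2) k (r : R) m
    (i : 'I_n.+2) :
  (forall x : k.+1.-tuple 'I_n.+2, tnth x ord0 = ord0 ->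
     (crossings x < m)%N -> phi k i x = 0) ->
  (stop_poly phi k r i)`_m = r ^+ uphalf m * crossing_mass phi k m i.
Proof.
move=> phi0; rewrite coef_sum /crossing_mass mulr_sumr.
rewrite [RHS]big_mkcondr; apply: eq_bigr => x /eqP x0; rewrite coefZ.
have [lt_m|le_m] := ltnP (crossings x) m.
  by rewrite phi0// !mul0r mulr0 if_same.
by rewrite coef_path_poly//; case: ifP => _; rewrite ?mulr0 // mulrCA.
Qed.

(** * Exactness forces the algorithm never to stop *)

Lemma delta_is_distribution (R : realType) n :
  is_distribution (delta_mx 0 ord0 : 'rV[R]_n.+2).
Proof.
split=> [i|]; first by rewrite mxE ler0n.
rewrite (bigD1 ord0) //= mxE !eqxx big1 ?addr0 // => j /negPf j0.
by rewrite mxE j0 andbF.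
Qed.

Lemma poly_eq_on_interval (R : realType) (d : R) (A B : {poly R}) : 0 < d ->
  (forall e, 0 < e < d -> A.[e] = B.[e]) -> A = B.
Proof.
move=> d0 AB; apply/eqP; rewrite -subr_eq0; apply/eqP.
pose s := [seq d / i.+2%:R | i <- iota 0 (size (A - B))].
apply: (@roots_geq_poly_eq0 _ _ s).
- apply/allP => _ /mapP[i _ ->]; rewrite rootE !hornerE AB ?subrr//.
  rewrite divr_gt0 ?ltr0n//= gtr_pMr// invf_lt1 ?ltr0n//.
  by rewrite ltr1n.
- rewrite map_inj_uniq ?iota_uniq// => i j /(mulfI (lt0r_neq0 d0)) /invr_inj.
  by move/eqP; rewrite eqr_nat => /eqP[].
- by rewrite size_map size_iota.
Qed.

(** Exactness at state 0 after clearing the denominator of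
$\pi_0 = 1/(r+1)$; it holds for all small $\varepsilon > 0$, hence as an
identity of polynomials. *)
Lemma stop_poly_exact (R : realType) n (phi : algorithm R n.+2) k (r : R) :
  interruptible_exact_sampler phi -> 0 < r ->
  r *: stop_poly phi k r ord0 = \sum_(j | j != ord0) stop_poly phi k r j.
Proof.
move=> sampler r0.
(* below 1 / (1 + r), both e and r * e are in the open unit interval *)
apply: (@poly_eq_on_interval _ (1 + r)^-1); first by rewrite invr_gt0; lra.
move=> e /andP[e0]; rewrite -[X in _ < X]mul1r ltr_pdivlMr; last by lra.
move=> er1.
have re0 : 0 < r * e by rewrite mulr_gt0.
have p01 : 0 < r * e < 1 by rewrite re0 /=; nra.
have q01 : 0 < e < 1 by rewrite e0 /=; nra.
rewrite hornerZ horner_stop_poly horner_sum.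
under eq_bigr => j _ do rewrite horner_stop_poly.
have := sampler_exact sampler (excursion_chain_reversible n p01 q01)
          (delta_is_distribution R n) ord0 k.
rewrite (bigD1 ord0) //= mxE /label_prob eqxx mul1r.
set a := stop_prob _ _ _ _ _; set b := \sum_(j | _) _.
have -> : e / (r * e + e) = (r + 1)^-1.
  by field; rewrite !gt_eqF //; lra.
have r1 : r + 1 != 0 by rewrite gt_eqF //; lra.
by move/(congr1 ( *%R (r + 1))); rewrite mulrA divff //; lra.
Qed.

(** Strong induction on the number $m$ of crossings, comparing the coefficients
of $\varepsilon^m$ in [stop_poly_exact] for $r = 1$ and $r = 2$. *)
Lemma no_stop_from0 (R : realType) n (phi : algorithm R n.+2) k :
  interruptible_exact_sampler phi ->
  forall (x : k.+1.-tuple 'I_n.+2) i, tnth x ord0 = ord0 -> phi k i x = 0.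
Proof.
move=> sampler x i; have [m] := ubnP (crossings x).
elim: m => // m IHm in x i *; rewrite ltnS leq_eqVlt => /orP[/eqP xm x0|];
  last by move=> lt_m; exact: IHm.
have phi_ge0 j y : 0 <= phi k j y.
  by case/andP: (sampler_unit_interval sampler j y).
have term_ge0 j y : 0 <= phi k j y * label_weight R y.
  by rewrite mulr_ge0 // ltW // label_weight_gt0.
have mass_ge0 j : 0 <= crossing_mass phi k m j by exact: sumr_ge0.
have balance r : 0 < r -> r * crossing_mass phi k m ord0 =
    \sum_(j | j != ord0) crossing_mass phi k m j.
  move=> r0; apply: (mulfI (expf_neq0 (uphalf m) (lt0r_neq0 r0))).
  have phi0 j y : tnth y ord0 = ord0 -> (crossings y < m)%N -> phi k j y = 0.
    by move=> y0 /IHm; exact.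
  have /(congr1 (coefp m)) := stop_poly_exact k sampler r0.
  rewrite /= coefZ coef_stop_poly; last by move=> y; exact: phi0.
  rewrite coef_sum.
  under [in X in _ = X -> _]eq_bigr => j _.
    rewrite coef_stop_poly; last by move=> y; exact: phi0.
    over.
  by rewrite -[X in _ = X -> _]mulr_sumr mulrCA.
have mass_sum0 : \sum_(j | j != ord0) crossing_mass phi k m j = 0.
  by have := balance 1 ltr01; have := balance 2 (ltr0n _ 2); lra.
have mass0 : crossing_mass phi k m i = 0.
  have [->|i0] := eqVneq i ord0.
    by have := balance 1 ltr01; rewrite mass_sum0 mul1r.
  by apply: (psumr_eq0P _ mass_sum0) => // j _.
have := psumr_eq0P (fun y _ => term_ge0 i y) mass0 (i := x).
rewrite x0 xm !eqxx => /(_ isT)/eqP.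
by rewrite mulf_eq0 (gt_eqF (label_weight_gt0 R x)) orbF => /eqP.
Qed.

Theorem mainTheorem5 (R : realType) (N : nat) (N_ge2 : (2 <= N)%N) :
  ~ exists phi : algorithm R N, interruptible_exact_sampler phi.
Proof.
case: N N_ge2 => [|[|n]] // _ [phi sampler].
have half01 : 0 < (2^-1 : R) < 1 by lra.
have [l] := sampler_stops sampler (excursion_chain_reversible n half01 half01)
  (delta_is_distribution R n).
under eq_fun => k.
  rewrite big1; last first.
    move=> j _; rewrite stop_prob_from0 big1 // => x /eqP x0.
    by rewrite (no_stop_from0 sampler) // mul0r.
  over.
move=> /(cvg_lim (@Rhausdorff R)); rewrite lim_cst; last exact: Rhausdorff.
by move=> <-; rewrite ltxx.
Qed.
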